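(* Let $k\le l\le m\le n$ be positive integers, let $a,b\in\mathbb{R}$ be distinct, and let $\mathbb{U},\mathbb{W}\subseteq\mathbb{R}^n$ be subspaces of dimensions $k$ and $m$ respectively with $\mathbb{U}\subseteq\mathbb{W}$. Let $Q=[q_1,\dots,q_n]\in\mathrm{O}_n(\mathbb{R})$ be such that $\operatorname{span}\{q_1,\dots,q_k\}=\mathbb{U}$ and $\operatorname{span}\{q_{k+1},\dots,q_{k+n-m}\}=\mathbb{W}^\perp$, and let \[ \Omega_{a,b}(\mathbb{U},\mathbb{W})=\left\{Q\begin{bmatrix}aI_k&0&0\\0&bI_{n-m}&0\\0&0&X\end{bmatrix}Q^{\mathsf T}: X\in\operatorname{Gr}_{a,b}(l-k,m-k)\right\}\subseteq \mathsf{S}^2(\mathbb{R}^n). \] Then \[ \mathsf{ED}\bigl(\Omega_{a,b}(\mathbb{U},\mathbb{W})\bigr)=\binom{m-k}{l-k}. \]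
   Context: For $\mathbb{F}=\mathbb{R}$ or $\mathbb{C}$, $\mathsf{S}^2(\mathbb{F}^n)=\{X\in\mathbb{F}^{n\times n}: X^{\mathsf T}=X\}$ (transpose, not conjugate transpose), and $\mathrm{O}_n(\mathbb{R})$ is the real orthogonal group. For integers $0\le r\le s$, $\operatorname{Gr}_{a,b}(r,s)=\{X\in \mathsf{S}^2(\mathbb{R}^s): (X-aI)(X-bI)=0,\ \operatorname{tr}(X)=ar+b(s-r)\}$, and $\operatorname{Gr}_{a,b}(r,s)^{\mathbb{C}}$ is the set of $X\in\mathsf{S}^2(\mathbb{C}^s)$ satisfying the same equations (for $s=0$ it consists of the empty matrix). The complex locus $\Omega_{a,b}(\mathbb{U},\mathbb{W})^{\mathbb{C}}\subseteq\mathsf{S}^2(\mathbb{C}^n)$ consists of the matrices of the same block form with $X\in\operatorname{Gr}_{a,b}(l-k,m-k)^{\mathbb{C}}$; it is a smooth affine variety. Euclidean distance degree: for a real affine variety $\mathcal{M}\subseteq \mathsf{S}^2(\mathbb{R}^n)$ with smooth complex locus $\mathcal{M}^{\mathbb{C}}$, and $A\in \mathsf{S}^2(\mathbb{R}^n)$, let $\delta_A:\mathcal{M}^{\mathbb{C}}\to\mathbb{C}$, $\delta_A(Y)=\tfrac12\sum_{i,j}(y_{ij}-a_{ij})^2$ (no absolute values). A point $Y\in\mathcal{M}^{\mathbb{C}}$ is stationary if $\operatorname{tr}(Z^{\mathsf T}(Y-A))=0$ for all $Z$ in the tangent space $\mathbb{T}_Y\mathcal{M}^{\mathbb{C}}$.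 Then $\mathsf{ED}(\mathcal{M})=N$ means that for generic $A$ (all $A\in \mathsf{S}^2(\mathbb{R}^n)$ outside some proper real algebraic subset) $\delta_A$ has exactly $N$ stationary points in $\mathcal{M}^{\mathbb{C}}$. *)

(* Defs.v *)
From HB Require Import structures.
From mathcomp Require Import all_boot all_order all_algebra.
From mathcomp Require Import complex.
From mathcomp Require Import boolp classical_sets cardinality reals.
From mathcomp Require Import mpoly.

Set Implicit Arguments.
Unset Strict Implicit.
Unset Printing Implicit Defensive.

Import Order.TTheory GRing.Theory Num.Theory.

Local Open Scope classical_set_scope.
Local Open Scope card_scope.
Local Open Scope ring_scope.

(* S^2(F^n): plain transpose, also over the complex numbers. *)
Definition Sym (F : Type) (n : nat) : set 'M[F]_n := [set X | X^T = X].
Arguments Sym : clear implicits.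

(* Polynomial functions of the n^2 entries of a matrix; the variable attached
   to the entry (i, j) is 'X_(mxvec_index i j). *)
Definition mxeval (F : fieldType) (n : nat) (p : {mpoly F[n * n]}) (Y : 'M[F]_n) : F :=
  p.@[fun v => mxvec Y 0 v].

(* Differential at Y of the polynomial function of p, applied to Z. *)
Definition mxdiff (F : fieldType) (n : nat) (p : {mpoly F[n * n]}) (Y Z : 'M[F]_n) : F :=
  \sum_v mxeval p^`M(v) Y * mxvec Z 0 v.

Definition zero_locus (F : fieldType) (n : nat) (P : set {mpoly F[n * n]}) :
    set 'M[F]_n :=
  Sym F n `&` [set Y | forall p, P p -> mxeval p Y = 0].

(* The real points and the complex points of one system of real polynomial
   equations on S^2. *)
Record real_variety (R : realType) (n : nat) := RealVariety {
  real_locus : set 'M[R]_n ;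
  complex_locus : set 'M[R[i]]_n ;
  real_varietyP : exists P : set {mpoly R[n * n]},
    real_locus = zero_locus P /\
    complex_locus = zero_locus [set map_mpoly (real_complex R) p | p in P]
}.

(* The tangent space at Y of the affine variety M, defined by the ideal of all
   polynomials vanishing on M; at a smooth point this is the tangent space of
   the underlying manifold. *)
Definition tangent_space (F : fieldType) (n : nat) (M : set 'M[F]_n) (Y : 'M[F]_n) :
    set 'M[F]_n :=
  [set Z | forall p : {mpoly F[n * n]},
     (forall X, M X -> mxeval p X = 0) -> mxdiff p Y Z = 0].

Definition stationary_points (R : realType) (n : nat) (M : real_variety R n)
    (A : 'M[R]_n) : set 'M[R[i]]_n :=
  [set Y | complex_locus M Y /\
     forall Z, tangent_space (complex_locus M) Y Z ->
       \tr (Z^T *m (Y - map_mx (real_complex R) A)) = 0].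

(* A property of A in S^2(R^n) that holds outside a proper real algebraic
   subset. *)
Definition generically (R : realType) (n : nat) (prop : 'M[R]_n -> Prop) : Prop :=
  exists P : set {mpoly R[n * n]},
    zero_locus P `<` Sym R n /\
    forall A, Sym R n A -> ~ zero_locus P A -> prop A.

Definition ED_degree (R : realType) (n : nat) (M : real_variety R n) (N : nat) : Prop :=
  generically (fun A => stationary_points M A #= `I_N).

(* Gr_{a,b}(r,s), for r <= s. *)
Definition Gr (F : fieldType) (a b : F) (r s : nat) : set 'M[F]_s :=
  [set X | [/\ Sym F s X, (X - a%:M) *m (X - b%:M) = 0 &
               \tr X = a * r%:R + b * (s - r)%:R]].

Arguments Gr {F} a b r s _.

Lemma block_dim (k m n : nat) : (k <= m -> m <= n -> k + ((n - m) + (m - k)) = n)%N.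
Proof. by move=> hkm hmn; rewrite addnCA subnKC // subnK. Qed.

(* diag(a I_k, b I_(n-m), X) *)
Definition block_diag (F : pzSemiRingType) (k m n : nat)
    (hkm : (k <= m)%N) (hmn : (m <= n)%N) (a b : F) (X : 'M[F]_(m - k)) : 'M[F]_n :=
  castmx (block_dim hkm hmn, block_dim hkm hmn)
    (block_mx (a%:M : 'M_k) 0 0 (block_mx (b%:M : 'M_(n - m)) 0 0 X)).

Definition Omega (F : fieldType) (k l m n : nat)
    (hkm : (k <= m)%N) (hmn : (m <= n)%N) (a b : F) (Q : 'M[F]_n) : set 'M[F]_n :=
  [set Q *m block_diag hkm hmn a b X *m Q^T | X in Gr a b (l - k) (m - k)].

Section OmegaEquations.
Variables (k l m n : nat) (hkm : (k <= m)%N) (hmn : (m <= n)%N).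

(* Over any commutative ring: the lower right block of Q^T Y Q, and the
   equations cutting out Omega among the symmetric matrices. *)
Definition Omega_corner (A : comNzRingType) (Q Y : 'M[A]_n) : 'M[A]_(m - k) :=
  drsubmx (drsubmx (castmx (esym (block_dim hkm hmn), esym (block_dim hkm hmn))
    (Q^T *m Y *m Q))).

Definition Omega_eq1 (A : comNzRingType) (a b : A) (Q Y : 'M[A]_n) : 'M[A]_n :=
  Q^T *m Y *m Q - block_diag hkm hmn a b (Omega_corner Q Y).

Definition Omega_eq2 (A : comNzRingType) (a b : A) (Q Y : 'M[A]_n) : 'M[A]_(m - k) :=
  (Omega_corner Q Y - a%:M) *m (Omega_corner Q Y - b%:M).

Definition Omega_eq3 (A : comNzRingType) (a b : A) (Q Y : 'M[A]_n) : A :=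
  \tr (Omega_corner Q Y) - (a * (l - k)%:R + b * (m - k - (l - k))%:R).

Section Morphism.
Variables (A B : comNzRingType) (f : {rmorphism A -> B}) (a b : A) (Q Y : 'M[A]_n).

Lemma map_block_diag X :
  map_mx f (block_diag hkm hmn a b X) = block_diag hkm hmn (f a) (f b) (map_mx f X).
Proof. by rewrite /block_diag map_castmx !map_block_mx !map_scalar_mx !map_mx0. Qed.

Lemma map_Omega_corner :
  map_mx f (Omega_corner Q Y) = Omega_corner (map_mx f Q) (map_mx f Y).
Proof.
by rewrite /Omega_corner !map_drsubmx map_castmx !map_mxM map_trmx.
Qed.

Lemma map_Omega_eq1 :
  map_mx f (Omega_eq1 a b Q Y) = Omega_eq1 (f a) (f b) (map_mx f Q) (map_mx f Y).
Proof.
by rewrite /Omega_eq1 map_mxB map_block_diag !map_mxM map_trmx map_Omega_corner.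
Qed.

Lemma map_Omega_eq2 :
  map_mx f (Omega_eq2 a b Q Y) = Omega_eq2 (f a) (f b) (map_mx f Q) (map_mx f Y).
Proof.
by rewrite /Omega_eq2 map_mxM !map_mxB !map_scalar_mx map_Omega_corner.
Qed.

Lemma map_Omega_eq3 :
  f (Omega_eq3 a b Q Y) = Omega_eq3 (f a) (f b) (map_mx f Q) (map_mx f Y).
Proof.
by rewrite /Omega_eq3 rmorphB rmorphD !rmorphM !rmorph_nat -map_Omega_corner
  trace_map_mx.
Qed.

End Morphism.

Lemma Omega_eqP (F : fieldType) (a b : F) (Q : 'M[F]_n) (hQ : Q^T *m Q = 1%:M)
    (Y : 'M[F]_n) :
  Omega l hkm hmn a b Q Y <->
  [/\ Sym F n Y, Omega_eq1 a b Q Y = 0, Omega_eq2 a b Q Y = 0 &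
      Omega_eq3 a b Q Y = 0].
Proof.
have hQ' : Q *m Q^T = 1%:M by apply: mulmx1C.
have cornerE X : Omega_corner Q (Q *m block_diag hkm hmn a b X *m Q^T) = X.
  rewrite /Omega_corner !mulmxA hQ mul1mx -mulmxA hQ mulmx1.
  by rewrite /block_diag castmx_comp castmx_id !block_mxKdr.
have trE X : (block_diag hkm hmn a b X)^T = block_diag hkm hmn a b X^T.
  by rewrite /block_diag trmx_cast /= !tr_block_mx !tr_scalar_mx !trmx0.
split=> [[X [sX eX tX] <-]|[sY e1 e2 e3]].
  split.
  - by rewrite /Sym /= !trmx_mul trmxK mulmxA trE sX.
  - by rewrite /Omega_eq1 cornerE !mulmxA hQ mul1mx -mulmxA hQ mulmx1 subrr.
  - by rewrite /Omega_eq2 cornerE.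
  - by rewrite /Omega_eq3 cornerE tX subrr.
exists (Omega_corner Q Y).
  split=> //; last by apply/eqP; rewrite -subr_eq0; apply/eqP.
  rewrite /Sym /= /Omega_corner !trmx_drsub trmx_cast /= !trmx_mul trmxK sY.
  by rewrite mulmxA.
move/eqP: e1; rewrite subr_eq0 => /eqP <-.
by rewrite !mulmxA hQ' mul1mx -mulmxA hQ' mulmx1.
Qed.

Section Equations.
Variables (R : realType) (a b : R) (Q : 'M[R]_n).

Let Xgen : 'M[{mpoly R[n * n]}]_n := \matrix_(i, j) 'X_(mxvec_index i j).
Let Qgen : 'M[{mpoly R[n * n]}]_n := map_mx (@mpolyC _ R) Q.

Definition Omega_equations : set {mpoly R[n * n]} :=
  [set p | [\/ exists i j, p = Omega_eq1 a%:MP b%:MP Qgen Xgen i j,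
               exists i j, p = Omega_eq2 a%:MP b%:MP Qgen Xgen i j |
               p = Omega_eq3 a%:MP b%:MP Qgen Xgen]].

Lemma Omega_zero_locus (F : fieldType) (g : {rmorphism R -> F}) :
  Q^T *m Q = 1%:M ->
  Omega l hkm hmn (g a) (g b) (map_mx g Q) =
  zero_locus [set map_mpoly g p | p in Omega_equations].
Proof.
move=> hQ; apply/seteqP.
have hgQ : (map_mx g Q)^T *m map_mx g Q = 1%:M.
  by rewrite map_trmx -map_mxM hQ map_mx1.
suff main Y : Sym F n Y -> [/\ Omega_eq1 (g a) (g b) (map_mx g Q) Y = 0,
    Omega_eq2 (g a) (g b) (map_mx g Q) Y = 0 &
    Omega_eq3 (g a) (g b) (map_mx g Q) Y = 0] <->
    forall p, Omega_equations p -> mxeval (map_mpoly g p) Y = 0.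
  split=> Y.
    case/(Omega_eqP _ _ hgQ) => sY e1 e2 e3; split=> // _ [p Pp <-].
    by apply: (main Y sY).1.
  case=> sY eY; apply/(Omega_eqP _ _ hgQ).
  have [//|e1 e2 e3] := (main Y sY).2; last by [].
  by move=> p Pp; apply: eY; exists p.
move=> sY.
pose f : {rmorphism {mpoly R[n * n]} -> F} :=
  (meval (fun v => mxvec Y 0 v) \o map_mpoly g)%FUN.
have fC c : f c%:MP = g c by rewrite /= map_mpolyC mevalC.
have fQ : map_mx f Qgen = map_mx g Q by apply/matrixP => i j; rewrite !mxE fC.
have fX : map_mx f Xgen = Y.
  by apply/matrixP => i j; rewrite !mxE /= map_mpolyX mevalXU mxvecE.
have E1 := map_Omega_eq1 f a%:MP b%:MP Qgen Xgen.
have E2 := map_Omega_eq2 f a%:MP b%:MP Qgen Xgen.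
have E3 := map_Omega_eq3 f a%:MP b%:MP Qgen Xgen.
rewrite !fC fQ fX in E1 E2 E3.
rewrite -E1 -E2 -E3; split.
  move=> [e1 e2 e3] p [[i [j ->]]|[i [j ->]]|->] //.
    by move/matrixP/(_ i j): e1; rewrite !mxE.
  by move/matrixP/(_ i j): e2; rewrite !mxE.
move=> h; split; last by apply: h; constructor 3.
- apply/matrixP => i j; rewrite mxE [RHS]mxE.
  by apply: h; constructor 1; exists i, j.
- apply/matrixP => i j; rewrite mxE [RHS]mxE.
  by apply: h; constructor 2; exists i, j.
Qed.

End Equations.

Lemma Omega_varietyP (R : realType) (a b : R) (Q : 'M[R]_n) (hQ : Q^T *m Q = 1%:M) :
  exists P : set {mpoly R[n * n]},
    Omega l hkm hmn a b Q = zero_locus P /\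
    Omega l hkm hmn (real_complex R a) (real_complex R b) (map_mx (real_complex R) Q)
      = zero_locus [set map_mpoly (real_complex R) p | p in P].
Proof.
exists (Omega_equations a b Q); split; last exact: Omega_zero_locus.
have := Omega_zero_locus a b idfun hQ; rewrite map_mx_id // => ->.
congr zero_locus; have mapid p : map_mpoly (@idfun R) p = p.
  by apply/mpolyP => u; rewrite mcoeff_map_mpoly.
apply/seteqP; split=> [_ [p Pp <-]|p Pp]; first by rewrite mapid.
by exists p.
Qed.

End OmegaEquations.

Definition Omega_variety (R : realType) (k l m n : nat)
    (hkm : (k <= m)%N) (hmn : (m <= n)%N) (a b : R) (Q : 'M[R]_n)
    (hQ : Q^T *m Q = 1%:M) : real_variety R n :=
  RealVariety (Omega_varietyP l hkm hmn a b hQ).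

(* V = W^perp for the standard inner product of R^n. *)
Definition is_orthogonal_complement (R : realType) (n : nat)
    (W V : {vspace 'cV[R]_n}) : Prop :=
  forall v, v \in V <-> forall w, w \in W -> w^T *m v = 0.

(* Main.v *)
(** Write [Omega = {Y0 + J X J^T : X in Gr}], where the columns of [J] are
    orthonormal and [J^T Y0 = 0].  The vectors tangent at [Y0 + J X J^T] have the
    form [J H J^T] with [H X + X H = (a + b) H], and they include all
    [J [K, X] J^T] with [K] skew-symmetric, the velocities of the Cayley curves
    [C X C^T], [C = (1 - tK)^-1 (1 + tK)].  Testing stationarity against the
    latter shows that [X] commutes with [B = J^T A J]; the former give the
    converse.  For generic [A] the discriminant of the characteristic polynomial
    of [B] is nonzero, so that [B = P^-1 D P] with distinct eigenvalues over the
    complex numbers, and the matrices [X] in [Gr] commuting with [B] are the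
    [P^-1 D' P] with [D'] diagonal having [l - k] entries equal to [a] and the
    others equal to [b].  They are automatically symmetric: [P P^T] commutes with
    [D], hence is diagonal and commutes with [D']. *)

Require Import Defs.
From HB Require Import structures.
From mathcomp Require Import all_boot all_order all_algebra.
From mathcomp Require Import separable.
From mathcomp Require Import complex.
From mathcomp Require Import boolp classical_sets cardinality reals.
From mathcomp Require Import mpoly.
From mathcomp Require Import ring.

Set Implicit Arguments.
Unset Strict Implicit.
Unset Printing Implicit Defensive.

Import Order.TTheory GRing.Theory Num.Theory.

Local Open Scope classical_set_scope.
Local Open Scope ring_scope.

(** * First-order expansions of rational curves *)

Section Jets.
Variable F : numFieldType.

Lemma poly_eq0_fun (p : {poly F}) : (forall t, p.[t] = 0) -> p = 0.
Proof.
move=> p0; apply/eqP; apply: contraT => nz_p.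
have := max_poly_roots nz_p (rs := [seq i%:R | i <- iota 0 (size p)]).
rewrite size_map size_iota ltnn; apply.
  by apply/allP => x _; rewrite rootE p0.
rewrite map_inj_uniq ?iota_uniq // => i j /eqP.
by rewrite eqr_nat => /eqP.
Qed.

(* [f] is a rational function of [t], regular at 0, with expansion
   [c + d t + O(t^2)]; where the denominator vanishes [f] is arbitrary. *)
Definition jet (f : F -> F) (c d : F) :=
  exists w g : {poly F}, w.[0] != 0 /\
    forall t, w.[t] != 0 -> f t * w.[t] = (c + d * t) * w.[t] + t ^+ 2 * g.[t].

Lemma eq_jet f g c d : f =1 g -> jet f c d -> jet g c d.
Proof.
by move=> fg [w [h [w0 E]]]; exists w, h; split=> // t /E <-; rewrite fg.
Qed.

Lemma jet_line c d : jet (fun t => c + d * t) c d.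
Proof.
exists 1, 0; split=> [|t _]; first by rewrite hornerC oner_neq0.
by rewrite !hornerC; ring.
Qed.

Lemma jet_cst c : jet (fun=> c) c 0.
Proof. by apply: (eq_jet _ (jet_line c 0)) => t; rewrite mul0r addr0. Qed.

Lemma jetD f g c d c' d' :
  jet f c d -> jet g c' d' -> jet (fun t => f t + g t) (c + c') (d + d').
Proof.
move=> [w [h [w0 E]]] [w' [h' [w'0 E']]].
exists (w * w'), (h * w' + h' * w); split=> [|t].
  by rewrite hornerM mulf_neq0.
rewrite hornerM mulf_eq0 negb_or => /andP[/E e /E' e'].
transitivity (f t * w.[t] * w'.[t] + g t * w'.[t] * w.[t]); first by ring.
rewrite e e' !hornerE /=; ring.
Qed.

Lemma jetM f g c d c' d' :
  jet f c d -> jet g c' d' ->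
  jet (fun t => f t * g t) (c * c') (d * c' + c * d').
Proof.
move=> [w [h [w0 E]]] [w' [h' [w'0 E']]].
exists (w * w'), (d%:P * d'%:P * w * w' + h * (c'%:P + d'%:P * 'X) * w'
  + h' * (c%:P + d%:P * 'X) * w + 'X^2 * h * h').
split=> [|t]; first by rewrite hornerM mulf_neq0.
rewrite hornerM mulf_eq0 negb_or => /andP[/E e /E' e'].
by rewrite mulrACA e e' !hornerE /=; ring.
Qed.

Lemma jet_sum (I : finType) (f : I -> F -> F) (c d : I -> F) :
  (forall i, jet (f i) (c i) (d i)) ->
  jet (fun t => \sum_i f i t) (\sum_i c i) (\sum_i d i).
Proof.
move=> fJ; elim: (index_enum I) => [|i s IH].
  rewrite !big_nil; apply: eq_jet (jet_cst 0) => t; by rewrite big_nil.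
rewrite !big_cons; apply: eq_jet (jetD (fJ i) IH) => t; by rewrite big_cons.
Qed.

(** After multiplication by [w * w'] the two expansions differ by a polynomial [q] vanishing
    wherever [v * w * w'] does not. Hence [v * w * w' * q = 0], so [q = 0], and its terms of order 0
    and 1 in [t] give the two equalities. *)
Lemma jet_unique f g c d c' d' (v : {poly F}) : v.[0] != 0 ->
  (forall t, v.[t] != 0 -> f t = g t) ->
  jet f c d -> jet g c' d' -> c = c' /\ d = d'.
Proof.
move=> v0 fg fJ [w' [h' [w'0 E']]].
case: fJ => w [h [w0 E]].
pose q := ((c - c')%:P + (d - d')%:P * 'X) * w * w' + 'X^2 * (h * w' - h' * w).
have q0 : v * w * w' * q = 0.
  apply: poly_eq0_fun => t; rewrite /q !hornerE /=.
  have [->|/fg e] := eqVneq v.[t] 0; first by rewrite !mul0r.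
  have [->|/E e1] := eqVneq w.[t] 0; first by rewrite !(mulr0, mul0r).
  have [->|/E' e2] := eqVneq w'.[t] 0; first by rewrite !(mulr0, mul0r).
  rewrite e in e1.
  suff -> : (c - c' + (d - d') * t) * w.[t] * w'.[t] +
     t ^+ 2 * (h.[t] * w'.[t] - h'.[t] * w.[t]) = 0 by rewrite mulr0.
  transitivity (((c + d * t) * w.[t] + t ^+ 2 * h.[t]) * w'.[t] -
    ((c' + d' * t) * w'.[t] + t ^+ 2 * h'.[t]) * w.[t]); first by ring.
  by rewrite -e1 -e2; ring.
have nz p : p.[0] != 0 -> p != 0 :> {poly F}.
  by apply: contraNneq => ->; rewrite horner0.
move/eqP: q0; rewrite mulf_eq0 (negPf (nz _ _)) /=; last first.
  by rewrite !hornerM !mulf_neq0.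
move=> /eqP q0.
have cc : c = c'.
  have := congr1 (horner^~ 0) q0; rewrite horner0.
  have -> : q.[0] = (c - c') * w.[0] * w'.[0] by rewrite !hornerE /=; ring.
  move/eqP; by rewrite !mulf_eq0 (negPf w0) (negPf w'0) !orbF subr_eq0 => /eqP.
split=> //.
have : 'X * ((d - d')%:P * w * w' + 'X * (h * w' - h' * w)) = 0.
  by rewrite -q0 /q cc subrr; ring.
move/eqP; rewrite mulf_eq0 polyX_eq0 /= => /eqP /(congr1 (horner^~ 0)).
rewrite horner0 hornerD [X in _ + X]hornerM hornerX mul0r addr0 !hornerM hornerC.
move/eqP; by rewrite !mulf_eq0 (negPf w0) (negPf w'0) !orbF subr_eq0 => /eqP.
Qed.

(** The chain rule: the property [P] holds for constants and variables and is stable under sums and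
    products. *)
Lemma jet_meval n (p : {mpoly F[n]}) (f : 'I_n -> F -> F) (c d : 'I_n -> F) :
  (forall i, jet (f i) (c i) (d i)) ->
  jet (fun t => p.@[fun i => f i t]) p.@[c] (\sum_i p^`M(i).@[c] * d i).
Proof.
move=> fJ.
pose P q := jet (fun t => q.@[fun i => f i t]) q.@[c] (\sum_i q^`M(i).@[c] * d i).
have PC a : P a%:MP.
  rewrite /P mevalC big1 => [|i _]; last by rewrite mderivC meval0 mul0r.
  by apply: eq_jet (jet_cst a) => t; rewrite mevalC.
have PX i : P 'X_i.
  have U0 : (U_(i) - U_(i) = 0 :> 'X_{1..n})%MM.
    by rewrite -{1}[U_(i)%MM]add0m addmK.
  rewrite /P mevalXU (bigD1 i) //= big1 => [|j ji].
    rewrite mderivX mnm1E eqxx scale1r U0 mpolyX0 meval1 mul1r addr0.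
    by apply: eq_jet (fJ i) => t; rewrite mevalXU.
  by rewrite mderivX mnm1E eq_sym (negPf ji) scale0r meval0 mul0r.
have PD q r : P q -> P r -> P (q + r).
  move=> Pq Pr; rewrite /P mevalD.
  have -> : \sum_i (q + r)^`M(i).@[c] * d i =
      \sum_i q^`M(i).@[c] * d i + \sum_i r^`M(i).@[c] * d i.
    by rewrite -big_split; apply: eq_bigr => i _; rewrite mderivD mevalD mulrDl.
  by apply: eq_jet (jetD Pq Pr) => t; rewrite mevalD.
have PM q r : P q -> P r -> P (q * r).
  move=> Pq Pr; rewrite /P mevalM.
  have -> : \sum_i (q * r)^`M(i).@[c] * d i =
      (\sum_i q^`M(i).@[c] * d i) * r.@[c] +
      q.@[c] * \sum_i r^`M(i).@[c] * d i.
    rewrite mulr_suml mulr_sumr -big_split; apply: eq_bigr => i _ /=.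
    by rewrite mderivM mevalD !mevalM; ring.
  by apply: eq_jet (jetM Pq Pr) => t; rewrite mevalM.
rewrite -/(P p); elim/mpolyind: p => [|a m p _ _ IH]; first exact: (PC 0).
apply: PD IH; rewrite -mul_mpolyC; apply: (PM _ _ (PC a)).
rewrite mpolyXE_id; elim/big_ind: _ => [||i _]; [exact: (PC 1) | exact: PM |].
elim: (m i) => [|k IHk]; first by rewrite expr0; exact: (PC 1).
by rewrite exprS; exact: PM.
Qed.

Definition mxjet m n (f : F -> 'M[F]_(m, n)) (A B : 'M[F]_(m, n)) :=
  forall i j, jet (fun t => f t i j) (A i j) (B i j).

Lemma mxjet_line m n (A B : 'M[F]_(m, n)) : mxjet (fun t => A + t *: B) A B.
Proof.
by move=> i j; apply: eq_jet (jet_line _ _) => t; rewrite !mxE mulrC.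
Qed.

Lemma mxjet_cst m n (A : 'M[F]_(m, n)) : mxjet (fun=> A) A 0.
Proof. by move=> i j; rewrite mxE; exact: jet_cst. Qed.

Lemma mxjetD m n f g (A B A' B' : 'M[F]_(m, n)) :
  mxjet f A B -> mxjet g A' B' -> mxjet (fun t => f t + g t) (A + A') (B + B').
Proof.
move=> fJ gJ i j; rewrite !mxE; apply: eq_jet (jetD (fJ i j) (gJ i j)) => t.
by rewrite mxE.
Qed.

Lemma mxjetM m n p f g (A B : 'M[F]_(m, n)) (A' B' : 'M[F]_(n, p)) :
  mxjet f A B -> mxjet g A' B' ->
  mxjet (fun t => f t *m g t) (A *m A') (B *m A' + A *m B').
Proof.
move=> fJ gJ i j; rewrite !mxE -big_split /=.
apply: eq_jet (jet_sum (fun k => jetM (fJ i k) (gJ k j))) => t.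
by rewrite mxE.
Qed.

Lemma mxjet_tr m n f (A B : 'M[F]_(m, n)) :
  mxjet f A B -> mxjet (fun t => (f t)^T) A^T B^T.
Proof.
by move=> fJ i j; rewrite !mxE; apply: eq_jet (fJ j i) => t; rewrite mxE.
Qed.

(** Supplies the polynomial off whose zeros the Cayley transform of [t *: K] is defined; its value
    at 0 is 1. *)
Lemma det_line n (K : 'M[F]_n) :
  exists v : {poly F}, forall t, v.[t] = \det (1%:M - t *: K).
Proof.
exists (\det (1%:M - 'X *: map_mx polyC K)) => t.
rewrite -[LHS]/(horner_eval t _) -det_map_mx; congr (\det _).
apply/matrixP => i j; rewrite !mxE /= /horner_eval !hornerE.
by case: (i == j); rewrite ?mulr1n ?mulr0n !hornerE.
Qed.

(** This rests on [(1 - tK)^-1 = 1 + tK + t^2 K^2 (1 - tK)^-1]. Multiplying by the denominator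
    [det (1 - tK)] turns the remainder into a polynomial, through the adjugate. *)
Lemma mxjet_inv n (K : 'M[F]_n) : mxjet (fun t => invmx (1%:M - t *: K)) 1%:M K.
Proof.
pose M : 'M[{poly F}]_n := 1%:M - 'X *: map_mx polyC K.
have ME t : map_mx (horner_eval t) M = 1%:M - t *: K.
  apply/matrixP => i j; rewrite !mxE /horner_eval !hornerE.
  by case: (i == j); rewrite ?mulr1n ?mulr0n !hornerE.
have detE t : (\det M).[t] = \det (1%:M - t *: K).
  by rewrite -[LHS]/(horner_eval t _) -det_map_mx ME.
move=> i j; exists (\det M), ((map_mx polyC (K *m K) *m \adj M) i j).
split=> [|t wt]; first by rewrite detE scale0r subr0 det1 oner_neq0.
have uM : 1%:M - t *: K \in unitmx by rewrite unitmxE -detE unitfE.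
have adjE : map_mx (horner_eval t) (\adj M) = (\det M).[t] *: invmx (1%:M - t *: K).
  rewrite map_mx_adj ME /invmx uM scalerA -detE mulfV ?scale1r //.
have -> : ((map_mx polyC (K *m K) *m \adj M) i j).[t] =
    (\det M).[t] * (K *m K *m invmx (1%:M - t *: K)) i j.
  have := congr1 (fun N : 'M_n => N i j)
    (map_mxM (horner_eval t) (map_mx polyC (K *m K)) (\adj M)).
  rewrite mxE /= /horner_eval => ->; rewrite adjE -scalemxAr mxE; congr (_ * _).
  congr ((_ *m _) i j); apply/matrixP => x y; by rewrite !mxE /horner_eval hornerC.
have E : invmx (1%:M - t *: K) =
    1%:M + t *: K + t ^+ 2 *: (K *m K *m invmx (1%:M - t *: K)).
  apply: (can_inj (mulmxK uM)); rewrite mulVmx // mulmxDl -scalemxAl.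
  rewrite -[_ *m invmx _ *m _]mulmxA mulVmx // mulmx1.
  rewrite mulmxDl !mulmxDr !mulmxN !mul1mx mulmx1 -!scalemxAl -!scalemxAr scalerA.
  by rewrite -expr2 addrA subrK subrK.
rewrite {1}E !mxE; ring.
Qed.

End Jets.

(** * Tangent spaces *)

Section Tangent.
Variable F : numFieldType.

(** With a matrix [E] of polynomials as witness, closure under sums and products follows from
    evaluation being a ring morphism, and [spectral_disc] can later be applied to [E] itself. *)
Definition polymap n p q (g : 'M[F]_n -> 'M[F]_(p, q)) :=
  exists E : 'M[{mpoly F[n * n]}]_(p, q),
    forall X, map_mx (meval (fun v => mxvec X 0 v)) E = g X.

Lemma polymap_id n : polymap (fun X : 'M[F]_n => X).
Proof.
exists (\matrix_(i, j) 'X_(mxvec_index i j)) => X.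
by apply/matrixP => i j; rewrite !mxE mevalXU mxvecE.
Qed.

Lemma polymap_cst n p q (A : 'M[F]_(p, q)) : polymap (fun _ : 'M[F]_n => A).
Proof.
exists (map_mx (@mpolyC _ F) A) => X.
by apply/matrixP => i j; rewrite !mxE mevalC.
Qed.

Lemma polymapD n p q (g h : 'M[F]_n -> 'M[F]_(p, q)) :
  polymap g -> polymap h -> polymap (fun X => g X + h X).
Proof. by move=> [D gD] [E hE]; exists (D + E) => X; rewrite map_mxD gD hE. Qed.

Lemma polymapM n p q r (g : 'M[F]_n -> 'M[F]_(p, q)) (h : 'M[F]_n -> 'M[F]_(q, r)) :
  polymap g -> polymap h -> polymap (fun X => g X *m h X).
Proof. by move=> [D gD] [E hE]; exists (D *m E) => X; rewrite map_mxM gD hE. Qed.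

Lemma jet_mxeval n (p : {mpoly F[n * n]}) f (Y Z : 'M[F]_n) :
  mxjet f Y Z -> jet (fun t => mxeval p (f t)) (mxeval p Y) (mxdiff p Y Z).
Proof.
move=> fJ; apply: (jet_meval p (f := fun i t => mxvec (f t) 0 i)) => k.
case/mxvec_indexP: k => i j; rewrite !mxvecE.
by apply: eq_jet (fJ i j) => t; rewrite mxvecE.
Qed.

(** The entries of [g] are polynomials vanishing on [M], so their differentials kill [Z]. Uniqueness
    of jets identifies these differentials with [G1], which can thus be computed by the product rule
    instead of partial derivatives. *)
Lemma tangent_eq n p q (M : set 'M[F]_n) (g : 'M[F]_n -> 'M[F]_(p, q)) Y Z G0 G1 :
  polymap g -> (forall X, M X -> g X = 0) ->
  mxjet (fun t => g (Y + t *: Z)) G0 G1 -> tangent_space M Y Z -> G1 = 0.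
Proof.
move=> [E gE] Mg gJ TZ; apply/matrixP => i j; rewrite mxE.
have evE X : mxeval (E i j) X = g X i j by rewrite -gE mxE.
have Ev0 : (1 : {poly F}).[0] != 0 by rewrite hornerC oner_neq0.
have [t _|_ ->] := jet_unique Ev0 _ (gJ i j) (jet_mxeval (E i j) (mxjet_line Y Z)).
  by rewrite evE.
by apply: TZ => X MX; rewrite evE Mg // mxE.
Qed.

(** A polynomial vanishing on [M] is zero along the curve off the zeros of [v], so its jet there is
    that of the constant 0. *)
Lemma tangent_curve n (M : set 'M[F]_n) f Y Z (v : {poly F}) : v.[0] != 0 ->
  (forall t, v.[t] != 0 -> M (f t)) -> mxjet f Y Z -> tangent_space M Y Z.
Proof.
move=> v0 Mf fJ p p0.
by have [t /Mf /p0|_ ->] := jet_unique v0 _ (jet_mxeval p fJ) (jet_cst 0).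
Qed.

End Tangent.

(** * Slices [Y0 + J X J^T] with [X] in [Gr]: tangent vectors and stationary points *)

Section Slice.
Variables (F : numFieldType) (n s r : nat) (a b : F).
Variables (J : 'M[F]_(n, s)) (Y0 : 'M[F]_n).
Hypotheses (JJ : J^T *m J = 1%:M) (JY0 : J^T *m Y0 = 0).

Definition slice : set 'M[F]_n := [set Y0 + J *m X *m J^T | X in Gr a b r s].

Lemma sliceK X : J^T *m (Y0 + J *m X *m J^T) *m J = X.
Proof.
by rewrite mulmxDr JY0 add0r !mulmxA JJ mul1mx -mulmxA JJ mulmx1.
Qed.

Lemma slice_inj : injective (fun X => Y0 + J *m X *m J^T).
Proof. by move=> X X' /(congr1 (fun Y => J^T *m Y *m J)); rewrite !sliceK. Qed.

Lemma tangent_slice X Z (H := J^T *m Z *m J) :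
  tangent_space slice (Y0 + J *m X *m J^T) Z ->
  Z = J *m H *m J^T /\ H *m X + X *m H = (a + b) *: H.
Proof.
set Y := Y0 + _ => TZ; have JYJ : J^T *m Y *m J = X by exact: sliceK.
split.
  (* Since [J^T Y0 = 0], every [V] in the slice satisfies [V - Y0 = J J^T V J J^T]; differentiating
     gives [Z = J H J^T]. *)
  pose g (Y : 'M[F]_n) := (Y + - Y0) + (- (J *m J^T)) *m Y *m (J *m J^T).
  have gP : polymap g.
    apply: polymapD; first by apply: polymapD (polymap_id _ _) (polymap_cst _ _).
    by apply: polymapM (polymapM (polymap_cst _ _) (polymap_id _ _)) (polymap_cst _ _).
  have gM V : slice V -> g V = 0.
    rewrite /g !mulNmx.
    have -> : J *m J^T *m V *m (J *m J^T) = J *m (J^T *m V *m J) *m J^T.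
      by rewrite !mulmxA.
    by move=> [X' _ <-]; rewrite sliceK addrAC addrK subrr.
  have gJ := mxjetD (mxjetD (mxjet_line Y Z) (mxjet_cst (- Y0)))
    (mxjetM (mxjetM (mxjet_cst (- (J *m J^T))) (mxjet_line Y Z))
      (mxjet_cst (J *m J^T))).
  have := tangent_eq gP gM gJ TZ.
  rewrite !(mul0mx, mulmx0, addr0, add0r) !mulNmx => /eqP.
  by rewrite subr_eq0 /H !mulmxA => /eqP.
(* Differentiating the quadratic equation of [Gr] gives [H (X - b) + (X - a) H = 0]. *)
pose g (Y : 'M[F]_n) := (J^T *m Y *m J + - a%:M) *m (J^T *m Y *m J + - b%:M).
have cP : polymap (fun Y : 'M[F]_n => J^T *m Y *m J).
  by apply: polymapM (polymapM (polymap_cst _ _) (polymap_id _ _)) (polymap_cst _ _).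
have gP : polymap g.
  by apply: polymapM; apply: polymapD cP (polymap_cst _ _).
have gM V : slice V -> g V = 0 by move=> [X' [_ X'0 _] <-]; rewrite /g sliceK.
have cJ := mxjetM (mxjetM (mxjet_cst J^T) (mxjet_line Y Z)) (mxjet_cst J).
have gJ := mxjetM (mxjetD cJ (mxjet_cst (- a%:M))) (mxjetD cJ (mxjet_cst (- b%:M))).
have := tangent_eq gP gM gJ TZ.
rewrite !(mul0mx, mulmx0, addr0, add0r) JYJ -/H mulmxDl mulmxDr mulmxN mulNmx.
rewrite mul_mx_scalar mul_scalar_mx addrACA -opprD -scalerDl => /eqP.
by rewrite subr_eq0 [b + a]addrC => /eqP.
Qed.

Lemma Gr_orthogonal C X : C *m C^T = 1%:M -> Gr a b r s X -> Gr a b r s (C *m X *m C^T).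
Proof.
move=> CC [sX eX tX]; have CC' := mulmx1C CC.
have E c : C *m X *m C^T - c%:M = C *m (X - c%:M) *m C^T.
  by rewrite mulmxBr mulmxBl mul_mx_scalar -scalemxAl CC scalemx1.
split.
- by rewrite /Sym /= !trmx_mul trmxK sX mulmxA.
- rewrite !E -!mulmxA [C^T *m (C *m _)]mulmxA CC' mul1mx.
  by rewrite [_ *m (_ *m C^T)]mulmxA eX mul0mx mulmx0.
- by rewrite mxtrace_mulC mulmxA CC' mul1mx.
Qed.

(** The Cayley transform [C t] of [t *: K] is orthogonal, so conjugation by it stays in [Gr]; its
    derivative at 0 is [K + K], whence the doubled [K] in the velocity. *)
Lemma slice_tangent X K : Gr a b r s X -> K^T = - K ->
  tangent_space slice (Y0 + J *m X *m J^T) (J *m ((K + K) *m X - X *m (K + K)) *m J^T).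
Proof.
move=> GX skK; have [v vE] := det_line K.
pose C t := invmx (1%:M - t *: K) *m (1%:M + t *: K).
have CJ : mxjet C 1%:M (K + K).
  have := mxjetM (mxjet_inv K) (mxjet_line 1%:M K).
  by rewrite !mulmx1 !mul1mx.
apply: (@tangent_curve _ _ _ (fun t => Y0 + J *m (C t *m X *m (C t)^T) *m J^T) _ _ v).
- by rewrite vE scale0r subr0 det1 oner_neq0.
- move=> t; rewrite vE -unitfE -unitmxE => u.
  exists (C t *m X *m (C t)^T) => //; apply: Gr_orthogonal => //.
  have trA : 1%:M + t *: K = (1%:M - t *: K)^T.
    by rewrite linearB linearZ /= skK trmx1 scalerN opprK.
  have cA : (1%:M - t *: K) *m (1%:M + t *: K) = (1%:M + t *: K) *m (1%:M - t *: K).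
    rewrite mulmxBl mulmxDl mulmxBr mulmxDr !mul1mx mulmxBr mulmxDr !mulmx1.
    by rewrite opprD !addrA addrK subrK.
  (* Here [C C^T = (1 - tK)^-1 (1 + tK) (1 - tK) (1 + tK)^-1], and exchanging the two middle factors
     gives 1. *)
  rewrite /C trmx_mul {2}trA trmxK trmx_inv -trA -!mulmxA.
  rewrite [(1%:M + _) *m (_ *m _)]mulmxA -cA -mulmxA mulmxV ?mulmx1 ?mulVmx //.
  by rewrite trA unitmx_tr.
- have := mxjetD (mxjet_cst Y0) (mxjetM (mxjetM (mxjet_cst J)
    (mxjetM (mxjetM CJ (mxjet_cst X)) (mxjet_tr CJ))) (mxjet_cst J^T)).
  have -> : (K + K)^T = - (K + K) by rewrite linearD /= skK opprD.
  by rewrite !(mul0mx, mulmx0, addr0, add0r) trmx1 !mul1mx !mulmx1 mulmxN.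
Qed.

Lemma stationary_slice A X (B := J^T *m A *m J) : a != b -> A^T = A -> Y0^T = Y0 ->
  Gr a b r s X ->
  (forall Z, tangent_space slice (Y0 + J *m X *m J^T) Z ->
     \tr (Z^T *m (Y0 + J *m X *m J^T - A)) = 0) <-> X *m B = B *m X.
Proof.
move=> ab sA sY0 GX; have [sX eX _] := GX.
have sB : B^T = B by rewrite /B !trmx_mul trmxK sA mulmxA.
set Y := Y0 + _; set C := X - B.
have JYJ : J^T *m (Y - A) *m J = C by rewrite mulmxBr mulmxBl sliceK.
have sC : C^T = C by rewrite linearB /= sX sB.
have trE H : \tr ((J *m H *m J^T)^T *m (Y - A)) = \tr (H *m C).
  rewrite -mxtrace_tr trmx_mul trmxK.
  have -> : (Y - A)^T = Y - A.
    by rewrite !linearB linearD /= sA sY0 !trmx_mul trmxK sX mulmxA.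
  by rewrite mxtrace_mulC -!mulmxA mxtrace_mulC -!mulmxA [J^T *m (_ *m _)]mulmxA JYJ.
split=> [st | XB Z /tangent_slice[ZE HX]].
  (* By cyclicity of the trace, [tr ([K, X] C) = tr (K [X, C])], and [[X, C] = N] because
     [C = X - B]. It remains to see that a skew [N] orthogonal to all skew [K] is zero. *)
  pose N := B *m X - X *m B.
  have trN K : K^T = - K -> \tr (K *m N) = 0.
    move=> skK; have := st _ (slice_tangent GX skK); rewrite trE.
    rewrite mulmxBl linearB /= -!mulmxA [\tr (X *m _)]mxtrace_mulC -mulmxA.
    rewrite -linearB /= -mulmxBr mulmxDl linearD /=.
    have -> : X *m C - C *m X = N.
      by rewrite /C mulmxBr mulmxBl opprB addrC addrA subrK.
    move/eqP; rewrite -mulr2n mulrn_eq0 => /eqP //.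
  have skN : N^T = - N by rewrite /N linearB /= (trmx_mul B X) (trmx_mul X B) sX sB opprB.
  suff : N = 0 by move/eqP; rewrite subr_eq0 => /eqP.
  apply/matrixP => i j; rewrite [RHS]mxE.
  have := trN (delta_mx i j - delta_mx j i).
  rewrite linearB /= !trmx_delta opprB => /(_ erefl).
  have trd k l : \tr (delta_mx k l *m N) = N l k.
    rewrite /mxtrace (bigD1 k) //= big1 ?addr0 => [|i' ik]; rewrite mxE (bigD1 l) //=.
      by rewrite mxE !eqxx mul1r big1 ?addr0 // => j' jl; rewrite mxE (negPf jl) andbF mul0r.
    by rewrite mxE (negPf ik) mul0r big1 ?addr0 // => j' jl; rewrite mxE (negPf ik) mul0r.
  rewrite mulmxBl linearB /= !trd.
  have -> : N j i = - N i j.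
    by have := congr1 (fun M : 'M_s => M i j) skN; rewrite [LHS]mxE [RHS]mxE.
  by move/eqP; rewrite -opprD oppr_eq0 -mulr2n mulrn_eq0 => /eqP.
(* With [N = X - b], the matrix [c^-1 N] is a projection. The relation on [H] says that [H]
   exchanges its image and kernel, while [C] commutes with [N] and preserves both; so [H C] has
   trace 0. *)
rewrite ZE trE; move: (J^T *m Z *m J) HX => H HX {ZE}; set c := a - b.
have c0 : c != 0 by rewrite subr_eq0.
pose N := X - b%:M.
have NN : N *m N = c *: N.
  move: eX; rewrite -/N (_ : X - a%:M = N - c%:M).
    by rewrite mulmxBl mul_scalar_mx => /eqP; rewrite subr_eq0 => /eqP.
  by rewrite /N /c raddfB opprB addrA subrK.
have HN : H *m N + N *m H = c *: H.
  rewrite mulmxBr mulmxBl mul_mx_scalar mul_scalar_mx addrACA HX -opprD -!scalerDl -scalerBl.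
  by congr (_ *: _); rewrite /c; ring.
have NHN : N *m H *m N = 0.
  have := congr1 (mulmx N) HN; rewrite mulmxDr !mulmxA NN -scalemxAl -scalemxAr.
  by move/eqP; rewrite -[X in _ == X]add0r (inj_eq (addIr _)) => /eqP.
have NC : N *m C = C *m N.
  rewrite /N /C !mulmxBl !mulmxBr XB !mul_mx_scalar !mul_scalar_mx.
  by rewrite !opprB addrACA [in RHS]addrACA; congr (_ + _); rewrite addrC.
have HNC : \tr (H *m N *m C) = 0.
  apply: (mulfI c0); rewrite mulr0 -linearZ /= scalemxAl scalemxAr -NN.
  by rewrite -!mulmxA NC mulmxA mulmxA mxtrace_mulC !mulmxA NHN mul0mx linear0.
apply: (mulfI c0); rewrite mulr0 -linearZ /= scalemxAl -HN mulmxDl linearD /=.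
by rewrite HNC add0r -mulmxA mxtrace_mulC -mulmxA -NC mulmxA.
Qed.
End Slice.

(** * Matrices of [Gr] commuting with a matrix with simple spectrum *)

Section SimpleSpectrum.

Lemma eigenvector_horner (F : fieldType) n (B : 'M[F]_n.+1) (v : 'rV_n.+1) z q :
  v *m B = z *: v -> v *m horner_mx B q = q.[z] *: v.
Proof.
move=> vB; elim/poly_ind: q => [|q c IH].
  by rewrite rmorph0 mulmx0 horner0 scale0r.
rewrite rmorphD rmorphM /= horner_mx_X horner_mx_C mulmxDr mulmxA IH -scalemxAl vB.
by rewrite mul_mx_scalar hornerMXaddC scalerA scalerDl.
Qed.

Lemma char_poly_similar (F : fieldType) n (P B D : 'M[F]_n) :
  P \in unitmx -> P *m B = D *m P -> char_poly B = char_poly D.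
Proof.
rewrite unitmxE unitfE => uP PB.
have : map_mx polyC P *m char_poly_mx B = char_poly_mx D *m map_mx polyC P.
  by rewrite mulmxBr mulmxBl -!map_mxM PB mul_mx_scalar mul_scalar_mx.
move/(congr1 determinant); rewrite !det_mulmx det_map_mx mulrC.
by apply: mulIf; rewrite polyC_eq0.
Qed.

Lemma char_poly_diag (F : comNzRingType) n (d : 'rV[F]_n) :
  char_poly (diag_mx d) = \prod_(x <- [seq d 0 i | i <- enum 'I_n]) ('X - x%:P).
Proof.
rewrite char_poly_trig ?diag_mx_is_trig // big_map big_enum /=.
by apply: eq_bigr => i _; rewrite mxE eqxx mulr1n.
Qed.

(* Up to sign, this is the discriminant of the characteristic polynomial. *)
Definition spectral_disc (F : comNzRingType) n (B : 'M[F]_n.+1) :=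
  \det (horner_mx B (char_poly B)^`()).

Lemma map_spectral_disc (F G : comNzRingType) (f : {rmorphism F -> G}) n (B : 'M[F]_n.+1) :
  f (spectral_disc B) = spectral_disc (map_mx f B).
Proof.
by rewrite /spectral_disc -map_char_poly deriv_map -map_horner_mx det_map_mx.
Qed.

(** The determinant is the product of the values of the derivative at the [d 0 i], which are simple
    roots. *)
Lemma spectral_disc_diag (F : fieldType) n (d : 'rV[F]_n.+1) :
  injective (d 0) -> spectral_disc (diag_mx d) != 0.
Proof.
move=> d_inj; rewrite /spectral_disc horner_mx_diag det_diag.
apply/prodf_neq0 => i _; rewrite mxE.
set p := char_poly _; have sep : separable_poly p.
  by rewrite /p char_poly_diag separable_prod_XsubC map_inj_uniq ?enum_uniq.
rewrite unlock in sep; apply: (coprimep_root sep).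
by rewrite /p char_poly_diag root_prod_XsubC map_f ?mem_enum.
Qed.

Lemma simple_spectrum (F : closedFieldType) n (B : 'M[F]_n.+1) :
  spectral_disc B != 0 ->
  exists (P : 'M_n.+1) (d : 'rV_n.+1),
    [/\ P \in unitmx, injective (d 0) & P *m B = diag_mx d *m P].
Proof.
move=> disc0; have sep : separable_poly (char_poly B).
  rewrite unlock; apply: Pdiv.ClosedField.root_coprimep => z.
  rewrite -eigenvalue_root_char => /eigenvalueP[v vB v0].
  apply: contraNneq v0 => qz; have := eigenvector_horner (char_poly B)^`() vB.
  rewrite qz scale0r => vq; have u : horner_mx B (char_poly B)^`() \in unitmx.
    by rewrite unitmxE unitfE.
  by rewrite -[v](mulmxK u) vq mul0mx.
have [rs] := closed_field_poly_normal (char_poly B).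
rewrite (monicP (char_poly_monic B)) scale1r => rsE.
have /diagonalizableP[P uP /(diagonalizable_forLR uP)[d]] : exists2 rs, uniq rs &
    mxminpoly B %| \prod_(x <- rs) ('X - x%:P).
  by exists rs; [rewrite -separable_prod_XsubC -rsE | rewrite -rsE mxminpoly_dvd_char].
rewrite mxpoly.conjVmx // => BE.
have PB : P *m B = diag_mx d *m P by rewrite BE !mulmxA mulmxV // mul1mx.
exists P, d; split=> //; apply/injectiveP.
by move: sep; rewrite (char_poly_similar uP PB) char_poly_diag separable_prod_XsubC.
Qed.

Lemma generic_simple_spectrum (R : numFieldType) (F : closedFieldType)
    (f : {rmorphism R -> F}) n s (J : 'M[R]_(n, s)) : J^T *m J = 1%:M ->
  exists D : {mpoly R[n * n]}, (exists2 A, A^T = A & mxeval D A != 0) /\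
    forall A, mxeval D A != 0 -> exists (P : 'M_s) (d : 'rV_s),
      [/\ P \in unitmx, injective (d 0) & P *m map_mx f (J^T *m A *m J) = diag_mx d *m P].
Proof.
case: s J => [|s] J JJ.
  exists 1; split=> [|A _].
    by exists 0; rewrite ?trmx0 // /mxeval meval1 oner_neq0.
  by exists 1%:M, 0; split=> [|[]|]; rewrite ?unitmx1 // ![_ *m _]flatmx0.
have [E EP] : polymap (fun A : 'M[R]_n => J^T *m A *m J).
  by apply: polymapM (polymapM (polymap_cst _ _) (polymap_id _ _)) (polymap_cst _ _).
have DE A : mxeval (spectral_disc E) A = spectral_disc (J^T *m A *m J).
  by rewrite -EP -map_spectral_disc.
(* The discriminant is nonzero as a polynomial: it does not vanish at
   [J diag(0, 1, ..., s - 1) J^T], whose compression by [J] has distinct eigenvalues in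
   characteristic zero. *)
exists (spectral_disc E); split=> [|A].
  pose d : 'rV[R]_s.+1 := \row_i (nat_of_ord i)%:R.
  exists (J *m diag_mx d *m J^T).
    by rewrite !trmx_mul trmxK tr_diag_mx mulmxA.
  rewrite DE !mulmxA JJ mul1mx -mulmxA JJ mulmx1; apply: spectral_disc_diag.
  by move=> i j /eqP; rewrite !mxE eqr_nat => /eqP/val_inj.
rewrite DE -(fmorph_eq0 f) map_spectral_disc; exact: simple_spectrum.
Qed.

End SimpleSpectrum.

Lemma card_set_finset (T : finType) (A : {set T}) : ([set x | x \in A] #= `I_#|A|)%card.
Proof.
have -> : [set x | x \in A] = @enum_val T (mem A) @` [set: 'I_#|A|].
  apply/seteqP; split=> [x xA|_ [i _ <-]]; last exact: enum_valP.
  by exists (enum_rank_in xA x) => //; rewrite enum_rankK_in.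
apply: card_eq_trans (inj_card_eq _) _; first by move=> i j _ _; exact: enum_val_inj.
by rewrite card_eq_sym; exact: card_II.
Qed.

(** In the eigenbasis of [B] these matrices are diagonal with entries [a] or [b], and the trace
    fixes the number of entries [a]; they thus correspond to the [r]-subsets of ['I_s]. *)
Lemma card_Gr_commutant (F : numFieldType) s r (a b : F) (B P : 'M[F]_s) (d : 'rV_s) :
  (r <= s)%N -> a != b -> B^T = B -> P \in unitmx -> injective (d 0) ->
  P *m B = diag_mx d *m P ->
  ([set X | Gr a b r s X /\ X *m B = B *m X] #= `I_'C(s, r))%card.
Proof.
move=> rs ab sB uP d_inj PB.
have diag_comm M : M *m diag_mx d = diag_mx d *m M ->
    M = diag_mx (\row_i M i i).
  move=> MD; apply/matrixP => i j; rewrite !mxE; have [->|ij] := eqVneq i j.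
    by rewrite mulr1n.
  have := congr1 (fun N : 'M_s => N i j) MD; rewrite mul_mx_diag mul_diag_mx !mxE.
  move/eqP; rewrite mulrC -subr_eq0 -mulrBl mulf_eq0 subr_eq0 => /orP[/eqP/d_inj e|/eqP ->].
    by rewrite e eqxx in ij.
  by rewrite mulr0n.
have diagC (u v : 'rV[F]_s) : diag_mx u *m diag_mx v = diag_mx v *m diag_mx u.
  by rewrite !mulmx_diag; congr diag_mx; apply/rowP => i; rewrite !mxE mulrC.
pose x (I : {set 'I_s}) : 'rV[F]_s := \row_i if i \in I then a else b.
pose f I := invmx P *m diag_mx (x I) *m P.
have PfP I : P *m f I *m invmx P = diag_mx (x I).
  by rewrite /f !mulmxA mulmxV // mul1mx mulmxK.
have f_inj : injective f.
  move=> I K /(congr1 (fun X => P *m X *m invmx P)); rewrite !PfP => e.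
  apply/setP => i; have := congr1 (fun M : 'M_s => M i i) e.
  rewrite !mxE eqxx !mulr1n; case: (i \in I); case: (i \in K) => // /eqP.
    by rewrite (negPf ab).
  by rewrite eq_sym (negPf ab).
have sum_x I : \tr (diag_mx (x I)) = a * #|I|%:R + b * (s%:R - #|I|%:R).
  rewrite mxtrace_diag.
  transitivity (\sum_i (b + (if i \in I then a - b else 0))).
    by apply: eq_bigr => i _; rewrite mxE; case: ifP; rewrite ?addr0 // addrC subrK.
  rewrite big_split /= -big_mkcond /= !sumr_const card_ord.
  by rewrite -(mulr_natr b) -(mulr_natr (a - b)); ring.
have tr_conj D : \tr (invmx P *m D *m P) = \tr D.
  by rewrite mxtrace_mulC mulmxA mulmxV // mul1mx.
(* The subtraction [s - r] in [Gr] is truncated; [r <= s] makes it genuine. *)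
have sumr_r : a * r%:R + b * (s - r)%:R = a * r%:R + b * (s%:R - r%:R).
  by rewrite natrB.
suff -> : [set X | Gr a b r s X /\ X *m B = B *m X] =
    f @` [set I | I \in [set I : {set 'I_s} | #|I| == r]%SET].
  apply: card_eq_trans (inj_card_eq _) _; first by move=> I K _ _; exact: f_inj.
  by have := card_set_finset [set I : {set 'I_s} | #|I| == r]%SET; rewrite card_draws card_ord.
apply/seteqP; split=> [X [[sX eX tX] XB] | _ [I /= + <-]].
  pose M := P *m X *m invmx P.
  have XM : X = invmx P *m M *m P by rewrite /M !mulmxA mulVmx // mul1mx mulmxKV.
  have BE : B = invmx P *m diag_mx d *m P by rewrite -mulmxA -PB mulKmx.
  have Md : M *m diag_mx d = diag_mx d *m M.
    have -> : diag_mx d = P *m B *m invmx P by rewrite PB mulmxK.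
    rewrite /M !mulmxA mulmxKV // mulmxKV //.
    by rewrite -[P *m X *m B]mulmxA XB mulmxA.
  have ME := diag_comm _ Md; set y := \row_i _ in ME.
  have yab i : y 0 i = a \/ y 0 i = b.
    have : (M - a%:M) *m (M - b%:M) = 0.
      have E c : M - c%:M = P *m (X - c%:M) *m invmx P.
        by rewrite mulmxBr mulmxBl mul_mx_scalar -scalemxAl mulmxV // scalemx1.
      by rewrite !E -!mulmxA mulKmx // [_ *m (_ *m invmx P)]mulmxA eX mul0mx mulmx0.
    have E c : M - c%:M = diag_mx (y - const_mx c).
      by rewrite linearB /= diag_const_mx -ME.
    rewrite !E mulmx_diag => /matrixP/(_ i i); rewrite !mxE eqxx mulr1n => /eqP.
    by rewrite mulf_eq0 !subr_eq0 => /orP[] /eqP ->; [left | right].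
  pose I := [set i | y 0 i == a]%SET.
  have yx : y = x I.
    apply/rowP => i; rewrite [RHS]mxE inE; case: eqP => [//|ya].
    by case: (yab i).
  exists I; last by rewrite /f -yx -ME -XM.
  rewrite /= inE -(eqr_nat F); apply/eqP.
  (* The two traces differ by [(a - b) (#|I| - r)], so [a != b] forces [#|I| = r]. *)
  move: tX; rewrite XM tr_conj ME yx sum_x sumr_r => /eqP; rewrite -subr_eq0.
  have -> : a * #|I|%:R + b * (s%:R - #|I|%:R) - (a * r%:R + b * (s%:R - r%:R)) =
    (a - b) * (#|I|%:R - r%:R) by ring.
  by rewrite mulf_eq0 subr_eq0 (negPf ab) /= subr_eq0 => /eqP.
rewrite inE => /eqP cI; split.
- split.
  + rewrite /Sym /=.
    have PP : P *m P^T *m diag_mx d = diag_mx d *m (P *m P^T).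
      have := congr1 trmx PB; rewrite !trmx_mul sB tr_diag_mx => BP.
      by rewrite -mulmxA -BP !mulmxA PB.
    have PPx : P *m P^T *m diag_mx (x I) = diag_mx (x I) *m (P *m P^T).
      by rewrite (diag_comm _ PP) diagC.
    have uPT : P^T \in unitmx by rewrite unitmx_tr.
    rewrite /f !trmx_mul tr_diag_mx trmx_inv mulmxA.
    (* Multiplying by [P] on the left and [P^T] on the right turns symmetry of [f I] into [PPx]. *)
    apply: (can_inj (mulmxK uPT)); apply: (can_inj (mulKmx uP)).
    by rewrite mulmxKV // !mulmxA mulmxV // mul1mx -[RHS]mulmxA -PPx.
  + have E c : f I - c%:M = invmx P *m (diag_mx (x I - const_mx c)) *m P.
      by rewrite linearB /= diag_const_mx mulmxBr mulmxBl mul_mx_scalar -scalemxAl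
        mulVmx // scalemx1.
    rewrite !E -!mulmxA mulKVmx // [X in invmx P *m X]mulmxA mulmx_diag.
    rewrite (_ : diag_mx _ = 0) ?mul0mx ?mulmx0 //.
    apply/matrixP => i j; rewrite !mxE; case: ifP => _; rewrite subrr ?mulr0 ?mul0r ?mul0rn //.
  + by rewrite tr_conj sum_x cI sumr_r.
have -> : B = invmx P *m diag_mx d *m P by rewrite -mulmxA -PB mulKmx.
by rewrite /f -!mulmxA !mulKVmx // ![diag_mx _ *m (_ *m _)]mulmxA diagC.
Qed.

(** * The varieties [Omega] *)

Section OmegaSlice.
Variables (k m n : nat) (hkm : (k <= m)%N) (hmn : (m <= n)%N).

Definition corner_incl (A : pzSemiRingType) : 'M[A]_(n, m - k) :=
  castmx (block_dim hkm hmn, erefl) (col_mx 0 (col_mx 0 1%:M)).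

Lemma block_diag_corner (F : pzRingType) (a b : F) (X : 'M[F]_(m - k)) :
  block_diag hkm hmn a b X =
  block_diag hkm hmn a b 0 + corner_incl F *m X *m (corner_incl F)^T.
Proof.
(* Once [n - m] is generalized to [p], the dimension equality can be eliminated by substituting for
   [n], and the casts disappear. *)
rewrite /block_diag /corner_incl; move: (n - m)%N (block_dim hkm hmn) => p e; case: _ / e.
rewrite !castmx_id !tr_col_mx !trmx0 trmx1.
have -> : col_mx 0 (col_mx 0 1%:M) *m X = col_mx 0 (col_mx 0 X) :> 'M_(k + (p + _), _).
  by rewrite !mul_col_mx !mul0mx mul1mx.
by rewrite !(mul_col_row, mulmx0, mul0mx, mulmx1, add_block_mx, addr0, add0r).
Qed.

Lemma corner_inclK (F : pzRingType) : (corner_incl F)^T *m corner_incl F = 1%:M.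
Proof.
rewrite /corner_incl; move: (n - m)%N (block_dim hkm hmn) => p e; case: _ / e.
by rewrite castmx_id !tr_col_mx !trmx0 trmx1 !mul_row_col !mul0mx mul1mx !add0r.
Qed.

Lemma corner_incl_block (F : pzRingType) (a b : F) :
  (corner_incl F)^T *m block_diag hkm hmn a b 0 = 0.
Proof.
rewrite /block_diag /corner_incl; move: (n - m)%N (block_dim hkm hmn) => p e; case: _ / e.
rewrite !castmx_id !tr_col_mx !trmx0 trmx1 !mul_row_block !mul0mx !mulmx0.
by rewrite !add0r !row_mx0.
Qed.

Lemma tr_block_diag0 (F : pzRingType) (a b : F) :
  (block_diag hkm hmn a b 0)^T = block_diag hkm hmn a b 0.
Proof. by rewrite /block_diag trmx_cast /= !tr_block_mx !tr_scalar_mx !trmx0. Qed.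

Lemma Omega_slice (F : numFieldType) l (a b : F) (Q : 'M[F]_n) :
  Omega l hkm hmn a b Q =
  slice (l - k) a b (Q *m corner_incl F) (Q *m block_diag hkm hmn a b 0 *m Q^T).
Proof.
have E X : Q *m block_diag hkm hmn a b X *m Q^T =
    Q *m block_diag hkm hmn a b 0 *m Q^T +
    Q *m corner_incl F *m X *m (Q *m corner_incl F)^T.
  by rewrite block_diag_corner mulmxDr mulmxDl trmx_mul !mulmxA.
by apply/seteqP; split=> _ [X GX <-]; exists X => //; rewrite E.
Qed.

End OmegaSlice.

(** * The Euclidean distance degree of [Omega] *)

Theorem corollary4p5 (R : realType) (k l m n : nat)
    (hk : (0 < k)%N) (hkl : (k <= l)%N) (hlm : (l <= m)%N) (hmn : (m <= n)%N)
    (a b : R) (hab : a <> b)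
    (U W : {vspace 'cV[R]_n})
    (hU : \dim U = k) (hW : \dim W = m) (hUW : (U <= W)%VS)
    (Q : 'M[R]_n) (hQ : Q^T *m Q = 1%:M)
    (hQU : <<[seq col i Q | i : 'I_n <- enum 'I_n & (i < k)%N]>>%VS = U)
    (hQW : is_orthogonal_complement W
             <<[seq col i Q | i : 'I_n <- enum 'I_n & (k <= i < k + (n - m))%N]>>%VS) :
  ED_degree (Omega_variety l (leq_trans hkl hlm) hmn a b hQ) 'C(m - k, l - k).

Proof.
set hkm := leq_trans hkl hlm; set f := real_complex R.
pose JR := Q *m corner_incl hkm hmn R.
have JRK : JR^T *m JR = 1%:M.
  by rewrite /JR trmx_mul -mulmxA [Q^T *m _]mulmxA hQ mul1mx corner_inclK.
have [D [[A0 sA0 DA0] DP]] := generic_simple_spectrum f JRK.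
(* The exceptional set is the hypersurface [D = 0] in the symmetric matrices, proper because the
   symmetric [A0] is not on it. *)
exists [set D]; split.
  split; first by move=> A [].
  by move=> /(_ A0 sA0) [_ /(_ D erefl)] /eqP; rewrite (negPf DA0).
move=> A sA DA; have {DA} /DP [P [d [uP d_inj PB]]] : mxeval D A != 0.
  by apply/eqP => DA0'; apply: DA; split=> // _ ->.
pose QC := map_mx f Q; pose J := QC *m corner_incl hkm hmn R[i].
pose Y0 := QC *m block_diag hkm hmn (f a) (f b) 0 *m QC^T.
have QCK : QC^T *m QC = 1%:M by rewrite /QC map_trmx -map_mxM hQ map_mx1.
have JE : map_mx f JR = J.
  rewrite /JR map_mxM /J; congr (_ *m _).
  by rewrite /corner_incl map_castmx !map_col_mx !map_mx0 map_mx1.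
have JJ : J^T *m J = 1%:M by rewrite -JE map_trmx -map_mxM JRK map_mx1.
have JY0 : J^T *m Y0 = 0.
  rewrite /J /Y0 trmx_mul -!mulmxA [QC^T *m (QC *m _)]mulmxA QCK mul1mx.
  by rewrite mulmxA corner_incl_block mul0mx.
have sY0 : Y0^T = Y0 by rewrite /Y0 !trmx_mul trmxK tr_block_diag0 mulmxA.
have fab : f a != f b by rewrite (inj_eq (fmorph_inj f)); apply/eqP.
have BE : map_mx f (JR^T *m A *m JR) = J^T *m map_mx f A *m J.
  by rewrite (map_mxM f (JR^T *m A) JR) (map_mxM f JR^T A) -map_trmx JE.
have sfA : (map_mx f A)^T = map_mx f A by rewrite map_trmx sA.
have sB : (map_mx f (JR^T *m A *m JR))^T = map_mx f (JR^T *m A *m JR).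
  by rewrite BE (trmx_mul _ J) (trmx_mul J^T) trmxK sfA mulmxA.
have := card_Gr_commutant (leq_sub2r k hlm) fab sB uP d_inj PB.
apply: card_eq_trans; rewrite card_eq_sym.
(* The stationary points are the image of the commutant of [B] in the complex [Gr] under the
   injective parametrization of the slice, so the count carries over. *)
have -> : stationary_points (Omega_variety l hkm hmn a b hQ) A =
    (fun X => Y0 + J *m X *m J^T) @` [set X | Gr (f a) (f b) (l - k) (m - k) X /\
      X *m map_mx f (JR^T *m A *m JR) = map_mx f (JR^T *m A *m JR) *m X].
  rewrite BE; apply/seteqP; rewrite /stationary_points /= Omega_slice.
  split=> [_ [[X GX <-] st]|_ [X [GX XB] <-]].
    by exists X => //; split=> //; apply/(stationary_slice JJ JY0 fab sfA sY0 GX).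
  split; first by exists X.
  by apply/(stationary_slice JJ JY0 fab sfA sY0 GX).
by rewrite card_eq_sym; apply: inj_card_eq => X X' _ _; exact: slice_inj.
Qed.
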